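(* Let $(\mathcal D,\mathcal I,i^\star)$ be an identification task with $K$ arms. For all $\omega\in\triangle_K^0$, any static proportions algorithm family $\mathcal A^{sp}_\omega$ parametrized by $\omega$ belongs to the class $\overline{\mathcal C^{sp}}$ and satisfies $$\sup_{\lambda\in\mathcal D}R_{H_{\mathcal C^{sp}},\infty}(\mathcal A^{sp}_\omega,\lambda)\le\Big(\min_{j\in[K]}\omega_j\Big)^{-1}.$$ In particular, for $\mathcal A_u\in\mathcal C^{sp}$ the uniform sampling algorithm (static proportions with $\omega=(1/K,\dots,1/K)$), $\sup_{\lambda\in\mathcal D}R_{H_{\mathcal C^{sp}},\infty}(\mathcal A_u,\lambda)\le K$.
   Context: Setting (fixed budget bandit identification). There are $K\ge 1$ arms. For each arm $k\in[K]=\{1,\dots,K\}$ a one-parameter canonical exponential family of real distributions is fixed; its members are identified with their means, which range over an open interval $\mathcal M_k$ (averages of samples lie in $\mathrm{cl}(\mathcal M_k)$). For $x,y\in\mathcal M_k$, $\mathrm{KL}(x,y)$ is the Kullback-Leibler divergence from the member with mean $x$ to the member with mean $y$. A bandit problem is identified with its mean vector $\mu\in\mathcal M_1\times\dots\times\mathcal M_K$. An identification task $(\mathcal D,\mathcal I,i^\star)$ consists of a finite answer set $\mathcal I$, a set $\mathcal D\subseteq\mathcal M_1\times\dots\times\mathcal M_K$, and a function $i^\star:\mathcal D\to\mathcal I$ such that, with $\mathcal D_i=\{\mu\in\mathcal D: i^\star(\mu)=i\}$, each $\mathcal D_i$ is open and equals the interior of its closure, and $\bigcup_{i}\mathrm{cl}(\mathcal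 D_i)\supseteq\mathcal M_1\times\dots\times\mathcal M_K$; at least two of the sets $\mathcal D_i$ are nonempty. $i^\star$ is extended with arbitrary values in $\mathcal I$ to all of $\mathrm{cl}(\mathcal M_1)\times\dots\times\mathrm{cl}(\mathcal M_K)$. $\mathrm{Alt}(\mu)=\{\lambda\in\mathcal D: i^\star(\lambda)\ne i^\star(\mu)\}$. An algorithm with horizon $T$: at each time $t=1,\dots,T$ it chooses an arm $k_t$ based on the previous observations and observes an independent sample from the distribution of arm $k_t$; after time $T$ it returns an answer $\hat i_T\in\mathcal I$ based on the observations. $N_{T,k}$ is the number of samples of arm $k$ up to time $T$ and $\hat\mu_{T,k}$ is their average. The error probability on problem $\mu$ is $p_{\mu,T}(\mathcal A)=\mathbb P_{\mu,\mathcal A}(\hat i_T\ne i^\star(\mu))$. An algorithm family is a sequence $\mathcal A=(\mathcal A_T)_{T\ge1}$ of algorithms, one for each horizon $T$; a class is a set of algorithm families. Let $h_{\mu,T}(\mathcal A)=T/\log(1/p_{\mu,T}(\mathcal A))\in[0,\infty]$ ($=0$ if $p_{\mu,T}=0$, $=\infty$ if $p_{\mu,T}=1$). The oracle difficulty of a class $\mathcal C$ is $H_{\mathcal C}(\mu)=\inf_{\mathcal A\in\mathcal C}\limsup_{T\to\infty}h_{\mu,T}(\mathcal A)$. Static proportions: let $\triangle_K^0=\{\omega\in\triangle_K:\omega_k>0\ \forall k\}$, with $\triangle_K$ the probability simplex. A static proportions algorithm family parametrized by $\omega\in\triangle_K^0$ is one whose sampling rule satisfies $|N_{T,k}-T\omega_k|\le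 K$ for all $T$ and all $k\in[K]$, and which returns $\hat i_T=i^\star(\hat\mu_T)$. $\mathcal C^{sp}$ is the class of all of these, for all $\omega\in\triangle_K^0$; its oracle difficulty equals $H_{\mathcal C^{sp}}(\mu)=\big(\sup_{\omega\in\triangle_K^0}\inf_{\lambda\in\mathrm{Alt}(\mu)}\sum_{k}\omega_k\mathrm{KL}(\lambda_k,\mu_k)\big)^{-1}$. Difficulty ratio with respect to $H:\mathcal D\to\mathbb R^+$: $R_{H,T}(\mathcal A,\mu)=h_{\mu,T}(\mathcal A)/H(\mu)$ and $R_{H,\infty}(\mathcal A,\mu)=\limsup_{T\to\infty}R_{H,T}(\mathcal A,\mu)$. The class $\overline{\mathcal C^{sp}}$ is the set of all algorithm families $\mathcal A$ with $\sup_{\mu\in\mathcal D}R_{H_{\mathcal C^{sp}},\infty}(\mathcal A,\mu)<+\infty$.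
   Formalization: The extension of i* to the boundary is not arbitrary: at boundary points with positive-mass endpoint coordinates lying in the closure of only one D_i, it must return i; with an arbitrary extension the bound fails, e.g. for two Bernoulli arms. *)

(* Defs.v *)
From HB Require Import structures.
From mathcomp Require Import all_boot all_order all_algebra.
From mathcomp Require Import all_classical all_reals all_analysis.

Set Implicit Arguments.
Unset Strict Implicit.
Unset Printing Implicit Defensive.

Import Order.TTheory GRing.Theory Num.Theory.
Import numFieldNormedType.Exports.

#[global] Open Scope classical_set_scope.
#[global] Open Scope ring_scope.

Section exponential_family.
Variable R : realType.
Implicit Types (nu : {measure set (measurableTypeR R) -> \bar R}) (th : R).

Definition partition_fun nu th : \bar R := \int[nu]_x (expR (th * x))%:E.

Definition ef_density nu th (x : R) : R :=
  expR (th * x - ln (fine (partition_fun nu th))).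

Definition ef_mean nu th : R := (\int[nu]_x (x * ef_density nu th x))%R.

(* A canonical exponential family: the distributions with density ef_density
   with respect to a base measure, for natural parameters in an open interval.
   The last field says that all samples, hence all averages of samples, lie in
   the closure of the set of means. *)
Record expFamily := ExpFamily {
  ef_base : {measure set (measurableTypeR R) -> \bar R} ;
  ef_param : set R ;
  ef_param_open : open ef_param ;
  ef_param_itv : is_interval ef_param ;
  ef_normalizable : forall th, ef_param th ->
    (partition_fun ef_base th < +oo)%E ;
  ef_mean_inj : set_inj ef_param (ef_mean ef_base) ;
  ef_means_open : open (ef_mean ef_base @` ef_param) ;
  ef_means_itv : is_interval (ef_mean ef_base @` ef_param) ;
  ef_support : ef_base (~` closure (ef_mean ef_base @` ef_param)) = 0%E }.

Definition means (F : expFamily) : set R := ef_mean (ef_base F) @` ef_param F.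

(* For m in means F, the natural parameter of the member with mean m. *)
Definition param_of_mean (F : expFamily) (m : R) : R :=
  xget 0 [set th | ef_param F th /\ ef_mean (ef_base F) th = m].

Definition member_expect (F : expFamily) (m : R) (f : R -> \bar R) : \bar R :=
  (\int[ef_base F]_x
     ((ef_density (ef_base F) (param_of_mean F m) x)%:E * f x))%E.

End exponential_family.

Section identification.
Variables (R : realType) (K : nat) (F : 'I_K -> expFamily R) (I : finType).
Implicit Types mu w : 'rV[R]_K.

Definition mean_vectors : set 'rV[R]_K :=
  [set mu | forall k, means (F k) (mu 0 k)].

Definition answer_region (D : set 'rV[R]_K) (istar : 'rV[R]_K -> I) (i : I) :
  set 'rV[R]_K := [set mu | D mu /\ istar mu = i].

(* task_ans is the correct answer on task_dom; elsewhere it is the extension,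
   used to turn empirical means into answers. *)
Record task := Task {
  task_dom : set 'rV[R]_K ;
  task_ans : 'rV[R]_K -> I ;
  task_dom_sub : task_dom `<=` mean_vectors ;
  task_open : forall i, open (answer_region task_dom task_ans i) ;
  task_regular : forall i,
    interior (closure (answer_region task_dom task_ans i))
    = answer_region task_dom task_ans i ;
  task_cover : mean_vectors `<=`
    \bigcup_(i in [set: I]) closure (answer_region task_dom task_ans i) ;
  task_nontrivial : exists i j, [/\ i != j,
    answer_region task_dom task_ans i !=set0 &
    answer_region task_dom task_ans j !=set0] }.

(* An empirical mean equals an endpoint of the set of means exactly when all its
   samples do, so with positive probability only if that endpoint is an atom of
   the base measure (as 0 and 1 are for Bernoulli arms). *)
Definition reachable : set 'rV[R]_K :=
  [set x : 'rV[R]_K | forall k, means (F k) (x 0 k) \/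
     (closure (means (F k)) (x 0 k) /\ (0 < ef_base (F k) [set x 0%R k])%E)].

(* Where only one answer i is possible, in that x is in the closure of the
   region of i and of no other, the extension returns i. On mean_vectors this
   follows from task_regular and task_cover, so it only constrains the
   extension at reachable boundary points. *)
Definition consistent_extension (P : task) :=
  forall (x : 'rV[R]_K) (i : I), reachable x ->
    (forall j, j != i ->
       ~ closure (answer_region (task_dom P) (task_ans P) j) x) ->
    task_ans P x = i.

(* Rules are functions of the sequence of past observations: the past arms are
   determined by it. alg_rule matters on sequences of length < T only and
   alg_answer on sequences of length T only. *)
Record algorithm (T : nat) := Algorithm {
  alg_rule : seq R -> 'I_K ;
  alg_answer : seq R -> I ;
  alg_rule_measurable : forall t k, (t < T)%N ->
    measurable [set h : t.-tuple (measurableTypeR R) | alg_rule h = k] ;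
  alg_answer_measurable : forall i,
    measurable [set h : T.-tuple (measurableTypeR R) | alg_answer h = i] }.

Definition algo_family := forall T, algorithm T.

(* The (t+1)-st arm sampled along h is the one chosen from the first t
   observations. *)
Definition arm_at T (A : algorithm T) (h : seq R) (t : nat) : 'I_K :=
  alg_rule A (take t h).

Definition num_samples T (A : algorithm T) (h : seq R) (k : 'I_K) : nat :=
  \sum_(0 <= t < size h) (arm_at A h t == k).

(* If arm k is not sampled along h, entry k is 0 / 0 = 0. *)
Definition empirical_mean T (A : algorithm T) (h : seq R) : 'rV[R]_K :=
  \row_k ((\sum_(0 <= t < size h | arm_at A h t == k) h`_t)
          / (num_samples A h k)%:R).

(* Expectation of f (the full history) on problem mu, given the history h and
   n remaining samples: successive integration against the distribution of the
   arm chosen from the current history. *)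
Fixpoint history_expect (rule : seq R -> 'I_K) mu (f : seq R -> \bar R)
    (n : nat) (h : seq R) : \bar R :=
  if n is n'.+1 then
    member_expect (F (rule h)) (mu 0 (rule h))
      (fun x => history_expect rule mu f n' (rcons h x))
  else f h.

Section difficulty.
Variable P : task.

Definition error_prob mu T (A : algorithm T) : \bar R :=
  history_expect (alg_rule A) mu
    (fun h => ((alg_answer A h != task_ans P mu)%:R)%:E) T [::].

Definition difficulty mu (A : algo_family) (T : nat) : \bar R :=
  let p := fine (error_prob mu (A T)) in
  if p == 0 then 0%E else if p == 1 then +oo%E else (T%:R / ln p^-1)%:E.

Definition oracle_difficulty (C : set algo_family) mu : \bar R :=
  ereal_inf [set limn_esup (difficulty mu A) | A in C].

Definition difficulty_ratio (H : 'rV[R]_K -> \bar R) (A : algo_family) mu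
    (T : nat) : \bar R :=
  (difficulty mu A T / H mu)%E.

Definition difficulty_ratio_lim (H : 'rV[R]_K -> \bar R) (A : algo_family) mu :
  \bar R :=
  limn_esup (difficulty_ratio H A mu).

Definition sup_difficulty_ratio (H : 'rV[R]_K -> \bar R) (A : algo_family) :
  \bar R :=
  ereal_sup [set difficulty_ratio_lim H A mu | mu in task_dom P].

Definition open_simplex : set 'rV[R]_K :=
  [set w | (forall k, 0 < w 0 k) /\ \sum_k w 0 k = 1].

Definition static_proportions w (A : algo_family) :=
  forall T (h : T.-tuple R), (0 < T)%N ->
    (forall k, `|(num_samples (A T) h k)%:R - T%:R * w 0 k| <= K%:R) /\
    alg_answer (A T) h = task_ans P (empirical_mean (A T) h).

Definition Csp : set algo_family :=
  [set A | exists2 w, open_simplex w & static_proportions w A].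

Definition Csp_bar : set algo_family :=
  [set A | (sup_difficulty_ratio (oracle_difficulty Csp) A < +oo)%E].

End difficulty.
End identification.

(* Main.v *)
Require Import Defs.
From mathcomp Require Import all_boot all_order all_algebra.
From mathcomp Require Import all_classical all_reals all_analysis.
From mathcomp Require Import ring lra.
Import Order.TTheory GRing.Theory Num.Theory.
Import numFieldNormedType.Exports measurable_realfun.

(* Both error exponents are compared with D, the infimum over alternatives l of
   sum_k KL(l_k, mu_k).  Products of likelihood ratios between members of the
   families are martingales for any sampling rule.
   Lower bound on the error of every static algorithm (change of measure from
   mu to an alternative l, under which the empirical means concentrate at l):
   its exponent is at most sum_k KL(l_k, mu_k), because each N_k <= T.  Hence
   the oracle difficulty is at least 1 / D.
   Upper bound for proportions w: an error puts the empirical mean in the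
   closure of the alternatives, which finitely many orthants pointing away from
   mu cover, with apices b such that sum_k KL(b_k, mu_k) is nearly at least D.
   In such an orthant the likelihood ratio of b against mu is at least
   exp(sum_k N_k KL(b_k, mu_k)), and N_k >= T min_j w_j - K.  Hence the exponent
   is at least D min_j w_j.
   All bounds compare the error indicator with an explicit combination of
   likelihood ratios, so the iterated integrals are only ever used through
   monotonicity and no measurability of the sampling rule is needed. *)

Set Implicit Arguments.
Unset Strict Implicit.
Unset Printing Implicit Defensive.

(** * Integral comparisons for functions of unknown measurability *)

Section lower_integral.
Context d (T : measurableType d) (R : realType).
Variable nu : {measure set T -> \bar R}.

(* No measurability: the integral of a nonnegative function is a supremum over
   the simple functions below it. *)
Lemma ge0_le_lower_integral (f g : T -> \bar R) :
  (forall x, 0 <= f x)%E -> (forall x, f x <= g x)%E ->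
  (\int[nu]_x f x <= \int[nu]_x g x)%E.
Proof.
move=> f0 fg; have g0 x : (0 <= g x)%E by exact: le_trans (f0 x) (fg x).
rewrite !ge0_integralTE//; apply: le_ereal_sup => _ [h hf <-].
by exists h => // x; exact: le_trans (hf x) (fg x).
Qed.

Lemma integrable_le_lower_integral (u : T -> R) (F : T -> \bar R) :
  nu.-integrable setT (EFin \o u) -> (forall x, 0 <= F x)%E ->
  (forall x, (u x)%:E <= F x)%E -> (\int[nu]_x (u x)%:E <= \int[nu]_x F x)%E.
Proof.
move=> iu F0 uF; apply: (@le_trans _ _ (\int[nu]_x ((EFin \o u)^\+ x))%E).
  apply: le_integral => //; first exact: integrable_funepos.
  by move=> x _; rewrite funeposE le_max lexx.
apply: ge0_le_lower_integral => // x.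
by rewrite funeposE ge_max uF F0.
Qed.

Lemma lower_integral_le_integrable (u : T -> R) (F : T -> \bar R) (G : set T) :
  nu.-integrable setT (EFin \o u) -> (forall x, 0 <= F x)%E ->
  measurable G -> nu (~` G) = 0%E -> (forall x, G x -> F x <= (u x)%:E)%E ->
  (\int[nu]_x F x <= \int[nu]_x (u x)%:E)%E.
Proof.
move=> iu F0 mG G0 Fu; have mu := measurable_int _ iu.
(* Nothing bounds [F] off [G], so the majorant is [+oo] there; the complement of [G] being null, its
   integral is still that of [u]. *)
pose v (x : T) : \bar R := if x \in G then (u x)%:E else +oo%E.
have mv : measurable_fun setT v.
  apply: measurable_fun_ifT => //.
  apply: (measurable_fun_bool true).
  rewrite (_ : _ @^-1` _ = G) ?setTI//.
  by apply/seteqP; split => x /=; [exact: set_mem|exact: mem_set].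
have uv : ae_eq nu setT v (EFin \o u).
  exists (~` G); split => //; first exact: measurableC.
  by move=> x /=; apply: contra_not => Gx _; rewrite /v mem_set.
rewrite -(ae_eq_integral _ _ measurableT mv mu uv).
apply: ge0_le_lower_integral => // x.
by rewrite /v; case: ifPn => [|_]; [rewrite inE => /Fu|rewrite leey].
Qed.

End lower_integral.

(** * Exponential families: log-partition function, natural parameter, divergence *)

Fact ef_key : unit. Proof. exact: tt. Qed.

Section exponential_family_theory.
Local Open Scope classical_set_scope.
Local Open Scope ring_scope.
Variables (R : realType) (E : expFamily R).
Let nu := ef_base E.
Implicit Types (x y m th : R).

(* Locked, as are nat_param and kl: unification would otherwise unfold integrals
   when comparing distinct parameters. *)
Definition log_partition th : R :=
  locked_with ef_key (fun th => ln (fine (partition_fun nu th))) th.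

Lemma log_partitionE th : log_partition th = ln (fine (partition_fun nu th)).
Proof. by rewrite /log_partition unlock. Qed.

Lemma measurable_ef_density th : measurable_fun setT (ef_density nu th).
Proof.
apply: measurableT_comp; first exact: measurable_expR.
apply: measurable_funB => //; exact: measurable_funM.
Qed.

(** If the partition function vanished, the base measure would be zero and every mean 0,
    contradicting the openness of the nonempty set of means. *)
Lemma partition_gt0 th : ef_param E th -> (0 < partition_fun nu th)%E.
Proof.
move=> Eth; rewrite lt0e integral_ge0 ?andbT; last first.
  by move=> x _; rewrite lee_fin expR_ge0.
apply/negP => /eqP Z0.
have mexp : measurable_fun setT (fun x : measurableTypeR R => (expR (th * x))%:E).
  apply/measurable_EFinP; apply: measurableT_comp; first exact: measurable_expR.
  exact: measurable_funM.
have nuT : nu setT = 0%E.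
  have : ae_eq nu setT (fun x => (expR (th * x))%:E) (cst 0%E).
    apply/ae_eq_integral_abs => //.
    rewrite -[RHS]Z0; apply: eq_integral => x _.
    by rewrite gee0_abs// lee_fin expR_ge0.
  case=> N [mN N0 NT]; apply/eqP; rewrite -measure_le0 -N0.
  rewrite le_measure ?inE// => x _; apply: NT => /= /(_ I) /eqP.
  by rewrite eqe gt_eqF// expR_gt0.
have mean0 t : ef_mean nu t = 0.
  rewrite /ef_mean /Rintegral (_ : integral _ _ _ = 0%E)//.
  apply: null_set_integral => //.
  apply/measurable_EFinP.
  by apply: measurable_funM => //; exact: measurable_ef_density.
have [e /= e0 eM] : nbhs (0 : R) (ef_mean nu @` ef_param E).
  by apply: open_nbhs_nbhs; split; [exact: ef_means_open | exists th].
have /eM [t _] : ball (0 : R) e (e / 2).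
  by rewrite /ball/= sub0r normrN gtr0_norm ?divr_gt0// ltr_pdivrMr// ltr_pMr// ltr1n.
by rewrite mean0 => /eqP; rewrite lt_eqF// divr_gt0.
Qed.

Lemma fine_partition_gt0 th : ef_param E th -> 0 < fine (partition_fun nu th).
Proof.
by move=> Eth; rewrite fine_gt0// partition_gt0//= ef_normalizable.
Qed.

Lemma ef_densityE th x : ef_param E th ->
  ef_density nu th x = (fine (partition_fun nu th))^-1 * expR (th * x).
Proof.
move=> Eth; have Z0 := fine_partition_gt0 Eth.
by rewrite /ef_density expRD expRN lnK ?posrE// [LHS]mulrC.
Qed.

Lemma integrable_expR th : ef_param E th ->
  nu.-integrable setT (fun x => (expR (th * x))%:E).
Proof.
move=> Eth; apply/integrableP; split.
  apply/measurable_EFinP; apply: measurableT_comp; first exact: measurable_expR.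
  exact: measurable_funM.
under eq_integral do rewrite gee0_abs ?lee_fin ?expR_ge0//.
exact: ef_normalizable.
Qed.

Lemma integrable_ef_density th : ef_param E th ->
  nu.-integrable setT (EFin \o ef_density nu th).
Proof.
move=> Eth; rewrite (_ : _ \o _ =
  (fun x => (fine (partition_fun nu th))^-1%:E * (expR (th * x))%:E)%E).
  exact/integrableZl/integrable_expR.
by apply/funext => x /=; rewrite ef_densityE.
Qed.

Lemma integral_ef_density th : ef_param E th ->
  (\int[nu]_x (ef_density nu th x)%:E = 1)%E.
Proof.
move=> Eth; under eq_integral do rewrite ef_densityE// EFinM.
rewrite integralZl//; last exact: integrable_expR.
rewrite -[X in (_ * X)%E]fineK; last first.
  by rewrite fin_real// ef_normalizable// (lt_trans _ (partition_gt0 Eth)).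
by rewrite -EFinM mulVf// gt_eqF// fine_partition_gt0.
Qed.

Lemma tilt_ef_density th th' x :
  ef_density nu th x *
    expR ((th' - th) * x - (log_partition th' - log_partition th))
  = ef_density nu th' x.
Proof. by rewrite /ef_density -expRD; congr expR; rewrite !log_partitionE; ring. Qed.

(** The open parameter set contains [th - t] and [th + t] for some [t > 0], and [t * |x|] is at most
    [exp(t * x) + exp(- t * x)]. *)
Lemma integrable_mean th : ef_param E th ->
  nu.-integrable setT (fun x => (x * ef_density nu th x)%:E).
Proof.
move=> Eth.
have [e /= e0 eE] : nbhs th (ef_param E).
  by apply: open_nbhs_nbhs; split => //; exact: ef_param_open.
pose t := e / 2.
have t0 : 0 < t by rewrite divr_gt0.
have te : t < e by rewrite ltr_pdivrMr// ltr_pMr// ltr1n.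
have Ep : ef_param E (th + t).
  by apply: eE; rewrite /= opprD addrA subrr sub0r normrN gtr0_norm.
have Em : ef_param E (th - t).
  by apply: eE; rewrite /= opprD addrA subrr sub0r opprK gtr0_norm.
pose z : R := (fine (partition_fun nu th))^-1.
have z0 : 0 <= z by rewrite invr_ge0 ltW// fine_partition_gt0.
pose c : R := z / t.
have ig : nu.-integrable setT
    (fun x => (c * (expR ((th + t) * x) + expR ((th - t) * x)))%:E).
  under eq_fun do rewrite EFinM EFinD.
  apply: integrableZl => //.
  by apply: integrableD => //; exact: integrable_expR.
apply: le_integrable ig => //.
  apply/measurable_EFinP; apply: measurable_funM => //.
  exact: measurable_ef_density.
move=> x _; rewrite !abse_EFin lee_fin ef_densityE// -/z /c.
rewrite [X in _ <= X]ger0_norm; last first.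
  by rewrite mulr_ge0// ?addr_ge0 ?expR_ge0// divr_ge0// ltW.
rewrite !normrM (ger0_norm z0) (ger0_norm (expR_ge0 _)).
rewrite mulrCA -[X in _ <= X]mulrA ler_wpM2l// ler_pdivlMl//.
rewrite mulrDl mulrBl !expRD -mulrDr mulrA mulrC ler_wpM2l ?expR_ge0//.
rewrite -{1}(ger0_norm (ltW t0)) -normrM.
have := @expR_ge1Dx R (t * x); have := @expR_ge1Dx R (- (t * x)).
have := expR_gt0 (t * x); have := expR_gt0 (- (t * x)).
by have [u0|u0] := ger0P (t * x); move=> *; lra.
Qed.

(* Gibbs' inequality, by integrating e^y >= e^c (1 + y - c). *)
Lemma log_partition_subgradient th th' : ef_param E th -> ef_param E th' ->
  (th' - th) * ef_mean nu th <= log_partition th' - log_partition th.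
Proof.
move=> Eth Eth'; rewrite -ler_expR.
(* [c] is the mean of [y = (th' - th) * x] under [th], so [y - c] integrates to zero and the lower
   bound integrates to [expR c]. *)
set c := _ * ef_mean _ _.
set r := log_partition th' - _.
have im := integrable_mean Eth; have id := integrable_ef_density Eth.
pose u x := expR c * ((1 - c) * ef_density nu th x + (th' - th) * (x * ef_density nu th x)).
have intM : (\int[nu]_x (x * ef_density nu th x)%:E = (ef_mean nu th)%:E)%E.
  by rewrite [RHS]fineK//; exact: integrable_fin_num.
have uE : (\int[nu]_x (u x)%:E = (expR c)%:E)%E.
  under eq_integral do rewrite /u EFinM EFinD (EFinM (1 - c)) (EFinM (th' - th)).
  rewrite integralZl//; last by apply: integrableD => //; exact: integrableZl.
  rewrite integralD//; [|exact: integrableZl|exact: integrableZl].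
  rewrite !integralZl// integral_ef_density// mule1 intM.
  by congr EFin; rewrite -/c /=; ring.
rewrite -lee_fin -uE.
have -> : (expR r)%:E = (\int[nu]_x (expR r * ef_density nu th' x)%:E)%E.
  under eq_integral do rewrite EFinM.
  by rewrite (integralZl _ (integrable_ef_density Eth'))// integral_ef_density// mule1.
apply: le_integral.
- exact: measurableT.
- under eq_fun do rewrite /u EFinM EFinD (EFinM (1 - c)) (EFinM (th' - th)).
  by apply: integrableZl => //; apply: integrableD => //; exact: integrableZl.
- under eq_fun do rewrite EFinM.
  exact: (integrableZl measurableT _ (integrable_ef_density Eth')).
move=> x _; rewrite lee_fin /u.
have -> : expR r * ef_density nu th' x = expR ((th' - th) * x) * ef_density nu th x.
  rewrite -(tilt_ef_density th th') -/r mulrCA -expRD mulrC; congr (expR _ * _).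
  by rewrite addrC subrK.
set f := ef_density _ _ _.
have f0 : 0 <= f by exact: expR_ge0.
rewrite (_ : _ + _ = (1 + ((th' - th) * x - c)) * f); last by ring.
rewrite mulrA ler_wpM2r//.
rewrite -[X in _ <= expR X](subrK c) expRD mulrC ler_wpM2r ?expR_ge0//.
by rewrite expR_ge1Dx.
Qed.

Definition nat_param x : R := locked_with ef_key (param_of_mean E) x.

Lemma nat_paramE x : nat_param x = param_of_mean E x.
Proof. by rewrite /nat_param unlock. Qed.

(** The log-density ratio of two members is affine in the sample; its mean under the member with
    mean [x] is this Bregman divergence of the log-partition function. *)
Definition kl x y : R := locked_with ef_key (fun x y =>
  (nat_param x - nat_param y) * x
  - (log_partition (nat_param x) - log_partition (nat_param y))) x y.

Lemma klE x y : kl x y = (nat_param x - nat_param y) * x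
  - (log_partition (nat_param x) - log_partition (nat_param y)).
Proof. by rewrite /kl unlock. Qed.

Lemma nat_paramP x : means E x ->
  ef_param E (nat_param x) /\ ef_mean nu (nat_param x) = x.
Proof.
move=> [th Eth thx]; rewrite nat_paramE.
by have := @xgetPex _ 0 [set t | ef_param E t /\ ef_mean nu t = x]; apply; exists th.
Qed.

Lemma kl_ge0 x y : means E x -> means E y -> 0 <= kl x y.
Proof.
move=> /nat_paramP [Ex xE] /nat_paramP [Ey _].
have := log_partition_subgradient Ex Ey.
by rewrite xE !klE; lra.
Qed.

Lemma klD x y : kl x y + kl y x
  = (nat_param x - nat_param y) * (x - y).
Proof. by rewrite !klE; ring. Qed.

(** Three-point identity of Bregman divergences. *)
Lemma kl_sub x y m : kl y m - kl x m
  = kl y x + (nat_param x - nat_param m) * (y - x).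
Proof. by rewrite !klE; ring. Qed.

Lemma kl_refl x : kl x x = 0.
Proof. by rewrite !klE; ring. Qed.

(** The two divergences between [x] and [y] sum to a product of differences, so the parameters
    cannot be in reverse order; nor can they be equal, since a parameter determines its mean. *)
Lemma nat_param_lt x y : means E x -> means E y ->
  x < y -> nat_param x < nat_param y.
Proof.
move=> Mx My xy.
have [Ex xE] := nat_paramP Mx; have [Ey yE] := nat_paramP My.
have [pxy|pyx] := ltP (nat_param x) (nat_param y); first by [].
have : nat_param y < nat_param x.
  rewrite lt_neqAle pyx andbT; apply/negP => /eqP exy.
  by move: xy; rewrite -xE -yE exy ltxx.
rewrite -subr_gt0 => pyx'.
have := kl_ge0 Mx My; have := kl_ge0 My Mx => kyx kxy.
have := klD x y; apply: contra_eqT => _; rewrite gt_eqF//.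
by rewrite (lt_le_trans _ (addr_ge0 kxy kyx))// nmulr_llt0// subr_lt0.
Qed.

Lemma nat_param_le x y : means E x -> means E y ->
  x <= y -> nat_param x <= nat_param y.
Proof.
move=> Mx My; rewrite le_eqVlt => /predU1P[->//|xy].
exact/ltW/nat_param_lt.
Qed.

(** By the three-point identity at the midpoint [z], the divergence is at least
    [(nat_param z - nat_param y) * (x - z)], positive by strict monotonicity. *)
Lemma kl_gt0 x y : means E x -> means E y -> x != y -> 0 < kl x y.
Proof.
move=> Mx My xy.
pose z := (x + y) / 2.
have Mz : means E z.
  by have [xy'|yx] := ltP x y;
     [apply: (@ef_means_itv _ E x y)|apply: (@ef_means_itv _ E y x)] => //;
     rewrite /z; apply/andP; split; lra.
have kxz := kl_ge0 Mx Mz; have kzy := kl_ge0 Mz My.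
rewrite -(subrK (kl z y) (kl x y)) kl_sub.
apply: ltr_wpDr => //; apply: ltr_wpDl => //.
have [xlty|yltx|exy] := ltgtP x y; last by rewrite exy eqxx in xy.
  by rewrite nmulr_lgt0 ?subr_lt0 ?nat_param_lt// /z; lra.
by rewrite mulr_gt0 ?subr_gt0 ?nat_param_lt// /z; lra.
Qed.

End exponential_family_theory.

(** * One-sided finite grids on an interval *)

Section intervals.
Variable R : realType.
Local Open Scope classical_set_scope.
Local Open Scope ring_scope.
Implicit Types (M : set R) (x y z m : R).

Lemma gt_nbhsl (a x : R) : a < x -> \forall y \near x, a < y.
Proof. by move=> ax; apply: open_nbhs_nbhs; split => //; exact: open_gt. Qed.

Lemma is_interval_between_closure M x y z : is_interval M ->
  closure M x -> closure M y -> x < z -> z < y -> M z.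
Proof.
move=> iM cx cy xz zy.
have [a [Ma /= az]] := cx _ (lt_nbhsl xz).
have [b [Mb /= zb]] := cy _ (gt_nbhsl zy).
by apply: (iM a b) => //; rewrite !ltW.
Qed.

(** [kap] stands for the divergence to [m], [g] for the natural parameter. Capped at [B], [kap]
    nearly reaches its supremum at some [t], which serves for all [x >= t]; between [m] and [t] the
    slope bound makes equal steps suffice. As [x] may lie outside [M], values are compared at nearby
    [z] in [M]. *)
Lemma grid_right M m (kap g : R -> R) (B e : R) :
  is_interval M -> M m -> 0 < e ->
  (forall y z, M y -> M z -> m <= y -> y <= z ->
     g y <= g z /\ kap y <= kap z <= kap y + (g z - g m) * (z - y)) ->
  exists s : seq R, (forall y, y \in s -> M y /\ m <= y) /\
    forall x, m < x -> exists y, [/\ y \in s, y <= x &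
      \forall z \near x, M z -> Num.min B (kap z) <= kap y + e].
Proof.
move=> iM Mm e0 H.
pose S : set R := (fun y => Num.min B (kap y)) @` [set y | M y /\ m <= y].
have supS : has_sup S.
  split; first by exists (Num.min B (kap m)), m.
  by exists B => _ [y _ <-]; rewrite ge_min lexx.
have [_ [t [Mt mt] <-] tS] := sup_adherent e0 supS.
have far z : M z -> m <= z -> Num.min B (kap z) <= kap t + e.
  move=> Mz mz; apply: (@le_trans _ _ (sup S)).
    by apply: ub_le_sup; [exact: supS.2|exists z].
  rewrite -lerBlDr (le_trans (ltW tS))// ge_min lexx orbT//.
(* [C] bounds the growth of [kap] over [[m, t]]; with at least [C / e] equal steps, each contributes
   at most [e]. *)
pose C := (g t - g m) * (t - m).
pose N := Num.truncn (C / e).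
have CN : C <= e * N.+1%:R.
  by rewrite mulrC -ler_pdivrMr// ltW// /N truncnS_gt.
pose d := (t - m) / N.+1%:R.
have d0 : 0 <= d by rewrite divr_ge0// subr_ge0.
pose Y i : R := m + i%:R * d.
have YN : Y N.+1 = t by rewrite /Y /d mulrC divfK// addrC subrK.
have leY i j : (i <= j)%N -> Y i <= Y j.
  by move=> ij; rewrite lerD2l ler_wpM2r// ler_nat.
have Ym i : m <= Y i by rewrite lerDl mulr_ge0.
have MY i : (i <= N.+1)%N -> M (Y i).
  by move=> iN; apply: (iM m t) => //; rewrite Ym -YN leY.
exists [seq Y i | i <- iota 0 N.+2]; split=> [y /mapP[i]|x mx].
  by rewrite mem_iota /= add0n ltnS => iN ->; split; [exact: MY|exact: Ym].
have mz : \forall z \near x, m < z by exact: gt_nbhsl.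
have [tx|xt] := leP t x.
  exists t; split => //; first by apply/mapP; exists N.+1; rewrite ?mem_iota ?YN//= add0n.
  by apply: filterS mz => z mz Mz; exact: far (ltW mz).
have exj : exists j, x < Y j by exists N.+1; rewrite YN.
(* The first grid point above [x] is not [Y 0 = m], so it has a predecessor at or below [x]. *)
case: (ex_minnP exj) => -[|i] xYi minY.
  by move: xYi; rewrite /Y mul0r addr0 ltNge (ltW mx).
have iN : (i < N.+1)%N by apply: minY; rewrite YN.
have Yix : Y i <= x by rewrite leNgt; apply/negP => /minY; rewrite ltnn.
exists (Y i); split=> //; first by apply/mapP; exists i; rewrite ?mem_iota//= add0n ltnS ltnW.
have zY : \forall z \near x, z < Y i.+1 by exact: lt_nbhsl.
apply: filterS2 mz zY => z mz zY Mz.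
rewrite ge_min; apply/orP; right.
have [Yz|zYi] := leP (Y i) z; last first.
  have [_ /andP[kk _]] := H z (Y i) Mz (MY _ (ltnW iN)) (ltW mz) (ltW zYi).
  by rewrite (le_trans kk)// lerDl ltW.
have zt : z <= t by rewrite -YN (le_trans (ltW zY))// leY.
have [_ /andP[_ kk]] := H _ _ (MY _ (ltnW iN)) Mz (Ym i) Yz.
apply: (le_trans kk); rewrite lerD2l.
have [gzt _] := H z t Mz Mt (ltW mz) zt.
have [gmz _] := H m z Mm Mz (lexx _) (ltW mz).
apply: (@le_trans _ _ ((g t - g m) * d)).
  apply: ler_pM; rewrite ?subr_ge0// ?lerD2r//.
  by rewrite lerBlDr (le_trans (ltW zY))// /Y -natr1 mulrDl mul1r; lra.
by rewrite /d mulrA ler_pdivrMr.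
Qed.

End intervals.

(** * Divergence grids, and the values of sample averages *)

Section kl_grid.
Variables (R : realType) (E : expFamily R).
Local Open Scope classical_set_scope.
Local Open Scope ring_scope.
Implicit Types (x y z m : R).

(** For [y] other than [m], the sign condition says that [x] lies at or beyond [y] as seen from [m].
    The grids on both sides of [m], together with [m] itself, serve every real [x]. *)
Lemma kl_grid m (B e : R) : means E m -> 0 < e ->
  exists s : seq R, (forall y, y \in s -> means E y) /\
    forall x, exists y, [/\ y \in s,
      0 <= (nat_param E y - nat_param E m) * (x - y) &
      \forall z \near x, means E z -> Num.min B (kl E z m) <= kl E y m + e].
Proof.
move=> Mm e0; pose th := nat_param E.
have th_le := @nat_param_le _ E.
(* Bounding [kl E z y] by the symmetrised divergence turns the three-point identity into a slope
   bound. *)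
have incr y z : means E y -> means E z ->
    kl E z m - kl E y m <= (th z - th m) * (z - y).
  by move=> My Mz; have := kl_sub E y z m; have := klD E y z; have := kl_ge0 My Mz;
    rewrite /th; lra.
have [s1 [Ms1 s1P]] : exists s : seq R, (forall y, y \in s -> means E y /\ m <= y) /\
    forall x, m < x -> exists y, [/\ y \in s, y <= x &
      \forall z \near x, means E z -> Num.min B (kl E z m) <= kl E y m + e].
  apply: (@grid_right _ (means E) m (kl E ^~ m) th B e) => //.
    exact: ef_means_itv.
  move=> y z My Mz my yz; split; first exact: th_le.
  have := incr _ _ My Mz; have := kl_sub E y z m; have := kl_ge0 Mz My.
  have : 0 <= (th y - th m) * (z - y) by rewrite mulr_ge0// subr_ge0// th_le.
  by rewrite /th => *; apply/andP; split; lra.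
(* Reflection [x -> - x] turns the natural parameter into [- th (- x)], so the one-sided grid also
   covers the left of [m]. *)
have [s2 [Ms2 s2P]] : exists s : seq R,
    (forall y, y \in s -> means E (- y) /\ - m <= y) /\
    forall x, - m < x -> exists y, [/\ y \in s, y <= x &
      \forall z \near x, means E (- z) -> Num.min B (kl E (- z) m) <= kl E (- y) m + e].
  apply: (@grid_right _ [set x | means E (- x)] (- m) (fun x => kl E (- x) m)
     (fun x => - th (- x)) B e) => //=; rewrite ?opprK//.
    move=> a b /= Ma Mb c /andP[ac cb]; apply: (@ef_means_itv _ E (- b) (- a)) => //.
    by rewrite !lerN2 ac cb.
  move=> y z My Mz my yz.
  have zy : - z <= - y by rewrite lerN2.
  have ym : - y <= m by rewrite lerNl.
  split; first by rewrite lerN2 th_le.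
  have := incr _ _ My Mz; have := kl_sub E (- y) (- z) m; have := kl_ge0 Mz My.
  have : 0 <= (th (- y) - th m) * (- z - - y).
    by rewrite mulr_le0// subr_le0// th_le.
  by rewrite /th => *; apply/andP; split; lra.
have [a [b [Ma Mb am mb]]] : exists a b, [/\ means E a, means E b, a < m & m < b].
  have [t /= t0 tM] : nbhs m (means E).
    by apply: open_nbhs_nbhs; split => //; exact: ef_means_open.
  have t2 : 0 < t / 2 by rewrite divr_gt0.
  have t2t : t / 2 < t by rewrite ltr_pdivrMr// ltr_pMr// ltr1n.
  exists (m - t / 2), (m + t / 2); split; rewrite ?ltrBlDr ?ltrDl//; apply: tM => /=.
    by rewrite opprB addrC subrK gtr0_norm.
  by rewrite opprD addrA subrr sub0r normrN gtr0_norm.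
exists (m :: s1 ++ map -%R s2); split=> [y|x].
  rewrite inE mem_cat => /or3P[/eqP->//|/Ms1[]//|/mapP[z /Ms2[Mz _] ->]//].
have [xm|mx|->] := ltgtP x m.
- have [|y [ys yx near_x]] := s2P (- x); first by rewrite ltrN2.
  exists (- y); split.
  + by rewrite inE mem_cat map_f ?orbT.
  + have [My my] := Ms2 _ ys.
    by rewrite mulr_le0// subr_le0 ?th_le// 1?lerNl// lerNr.
  + have : - z @[z --> x] --> - x by apply: cvgN; exact: cvg_id.
    move=> /(_ _ near_x) near_x'.
    have {}near_x' : nbhs x (fun z => means E (- - z) ->
      Num.min B (kl E (- - z) m) <= kl E (- y) m + e) := near_x'.
    by apply: filterS near_x' => z; rewrite opprK.
- have [y [ys yx near_x]] := s1P _ mx.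
  have [My my] := Ms1 _ ys.
  exists y; split => //; first by rewrite inE mem_cat ys orbT.
  by rewrite mulr_ge0// subr_ge0// th_le.
(* At [x = m] the point [m] itself serves: for [z] between [a] and [b] the divergence to [m] is at
   most [(th b - th a) * |z - m|]. *)
- exists m; split; rewrite ?mem_head ?subrr ?mul0r//.
  have C0 : 0 < th b - th a.
    by rewrite subr_gt0 nat_param_lt// (lt_trans am).
  have near1 : \forall z \near m, a < z by exact: gt_nbhsl.
  have near2 : \forall z \near m, z < b by exact: lt_nbhsl.
  have near3 : \forall z \near m, `|m - z| < e / (th b - th a).
    by exists (e / (th b - th a)); rewrite //= divr_gt0.
  apply: filterS3 near1 near2 near3 => z az zb mz Mz.
  rewrite ge_min kl_refl add0r; apply/orP; right.
  have := incr _ _ Mm Mz; rewrite kl_refl subr0 => /le_trans; apply.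
  rewrite ltr_pdivlMr// in mz; rewrite (le_trans _ (ltW mz))// mulrC.
  rewrite (le_trans (ler_norm _))// normrM distrC ler_wpM2l//.
  have := th_le _ _ Ma Mz (ltW az); have := th_le _ _ Mz Mb (ltW zb).
  have := th_le _ _ Ma Mm (ltW am); have := th_le _ _ Mm Mb (ltW mb).
  rewrite -/th => *; rewrite ler_norml; apply/andP; split; lra.
Qed.

(* The values an average of samples can take; reachable is the product over
   the arms of these intervals. *)
Definition sample_values : set R := [set x | means E x \/
  (closure (means E) x /\ (0 < ef_base E [set x])%E)].

Lemma sample_values_closure x : sample_values x -> closure (means E) x.
Proof. by case=> [|[]//]; exact: subset_closure. Qed.

Lemma is_interval_sample_values : is_interval sample_values.
Proof.
move=> x y Sx Sy z /andP[]; rewrite le_eqVlt => /predU1P[<-//|xz].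
rewrite le_eqVlt => /predU1P[->//|zy]; left.
by apply: (is_interval_between_closure _ (sample_values_closure Sx)
  (sample_values_closure Sy)) => //; exact: ef_means_itv.
Qed.

Lemma measurable_sample_values : measurable (sample_values : set (measurableTypeR R)).
Proof. exact: is_interval_measurable is_interval_sample_values. Qed.

(** Outside the closure of the means the base measure vanishes by [ef_support]; what remains are
    endpoints without mass, at most one on each side. *)
Lemma sample_values_full : ef_base E (~` sample_values) = 0%E.
Proof.
apply: measure_negligible; first by apply: measurableC; exact: measurable_sample_values.
pose U : set R := [set x | closure (means E) x /\ ~ sample_values x].
(* [Ul] can only hold the right endpoint, [Ur] only the left one. *)
pose Ul := [set x | U x /\ forall a, means E a -> a <= x].
pose Ur := [set x | U x /\ forall a, means E a -> x <= a].
have null (V : set R) : (forall x y, V x -> V y -> x < y -> False) ->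
    (forall x, V x -> U x) -> (ef_base E).-negligible V.
  move=> V1 VU; have [[x Vx]|V0] := pselect (exists x, V x); last first.
    by rewrite (_ : V = set0); [exact: negligible_set0|apply/seteqP; split => // x Vx; case: V0; exists x].
  have -> : V = [set x].
    apply/seteqP; split=> [y Vy /=|y -> //].
    by have [yx|xy|//] := ltgtP y x; [case: (V1 _ _ Vy Vx)|case: (V1 _ _ Vx Vy)].
  have [cx nSx] := VU _ Vx.
  exists [set x]; split => //.
  apply: contrapT => nux; apply: nSx; right; split => //.
  by rewrite lt0e measure_ge0 andbT; apply/eqP.
apply: (@negligibleS _ _ _ (ef_base E) ((~` closure (means E)) `|` (Ul `|` Ur))).
  move=> x nSx; have [cx|ncx] := pselect (closure (means E) x); [right|by left].
  have nMx : ~ means E x by move=> Mx; apply: nSx; left.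
  have sub := @subset_closure _ (means E).
  have [m Mm] : exists m, means E m by have [m [Mm _]] := cx _ filterT; exists m.
  have [mx|xm|xm] := ltgtP m x; last by rewrite -xm in nMx.
    left; split=> // a Ma; rewrite leNgt; apply/negP => xa; apply: nMx.
    exact: (is_interval_between_closure (@ef_means_itv _ E) (sub _ Mm) (sub _ Ma)).
  right; split=> // a Ma; rewrite leNgt; apply/negP => ax; apply: nMx.
  exact: (is_interval_between_closure (@ef_means_itv _ E) (sub _ Ma) (sub _ Mm)).
apply: negligibleU.
  exists (~` closure (means E)); split => //; last exact: ef_support.
  by apply: measurableC; exact: closed_measurable (@closed_closure _ _).
apply: negligibleU; apply: null => [x y|x []//].
- move=> [_ xub] [[cy _] _] xy; have [a [Ma /= xa]] := cy _ (gt_nbhsl xy).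
  by have := xub _ Ma; rewrite leNgt xa.
- move=> [[cx _] _] [_ ylb] xy; have [a [Ma /= ay]] := cx _ (lt_nbhsl xy).
  by have := ylb _ Ma; rewrite leNgt ay.
Qed.

End kl_grid.

(** * Histories, martingales and likelihood ratios *)

Section histories.
Local Open Scope classical_set_scope.
Local Open Scope ring_scope.
Variables (R : realType) (K : nat) (F : 'I_K -> expFamily R).
Variable rule : seq R -> 'I_K.
Implicit Types (mu b : 'rV[R]_K) (h : seq R) (k : 'I_K) (W : seq R -> R).

Definition arm_count h k : nat :=
  \sum_(0 <= t < size h) (rule (take t h) == k).

Definition arm_sum h k : R :=
  \sum_(0 <= t < size h | rule (take t h) == k) h`_t.

(** By [sample_values_full] these histories carry all the mass; once every arm is sampled, their
    empirical means are reachable. *)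
Definition typical h := forall t, (t < size h)%N ->
  sample_values (F (rule (take t h))) h`_t.

Lemma take_rcons t h x : (t <= size h)%N -> take t (rcons h x) = take t h.
Proof. by move=> th; rewrite -cats1 takel_cat. Qed.

Lemma arm_count_rcons h x k :
  arm_count (rcons h x) k = (arm_count h k + (rule h == k))%N.
Proof.
rewrite /arm_count size_rcons big_nat_recr//= take_rcons// take_size; congr addn.
by apply: eq_big_nat => t /andP[_ th]; rewrite take_rcons// ltnW.
Qed.

Lemma arm_sum_rcons h x k :
  arm_sum (rcons h x) k = arm_sum h k + (rule h == k)%:R * x.
Proof.
rewrite /arm_sum big_mkcond size_rcons big_nat_recr//= take_rcons// take_size.
rewrite nth_rcons ltnn eqxx [in RHS]big_mkcond; congr (_ + _); last first.
  by case: eqP; rewrite ?mul1r ?mul0r.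
apply: eq_big_nat => t /andP[_ th].
by rewrite take_rcons 1?ltnW// nth_rcons th.
Qed.

Lemma arm_count_le h k : (arm_count h k <= size h)%N.
Proof.
rewrite /arm_count -[X in (_ <= X)%N]subn0 -[X in (_ <= X)%N]muln1 -sum_nat_const_nat.
by apply: leq_sum => t _; case: eqP.
Qed.

Lemma typical_nil : typical [::].
Proof. by []. Qed.

Lemma typical_rcons h x : typical (rcons h x) <->
  typical h /\ sample_values (F (rule h)) x.
Proof.
split=> [th|[th Sx] t].
  split=> [t tsz|]; last first.
    have := th (size h); rewrite size_rcons ltnS leqnn => /(_ isT).
    by rewrite take_rcons// take_size nth_rcons ltnn eqxx.
  have := th t; rewrite size_rcons ltnS (ltnW tsz) => /(_ isT).
  by rewrite take_rcons 1?ltnW// nth_rcons tsz.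
rewrite size_rcons ltnS leq_eqVlt => /predU1P[->|tsz].
  by rewrite take_rcons// take_size nth_rcons ltnn eqxx.
by rewrite take_rcons 1?ltnW// nth_rcons tsz; exact: th.
Qed.

(** Each new average lies between the previous one and the new sample, and the sample values form an
    interval. *)
Lemma typical_average h k : typical h -> (0 < arm_count h k)%N ->
  sample_values (F k) (arm_sum h k / (arm_count h k)%:R).
Proof.
elim/last_ind: h => [_|h x IH]; first by rewrite /arm_count big_nil.
move=> /typical_rcons[/IH{}IH Sx]; rewrite arm_sum_rcons arm_count_rcons.
have [rk|_] := eqVneq (rule h) k; last by rewrite addn0 mul0r addr0.
rewrite rk in Sx; rewrite mul1r addn1 => _.
have [N0|N0] := posnP (arm_count h k).
  suff -> : arm_sum h k = 0 by rewrite N0 divr1 add0r.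
  move/eqP: N0; rewrite /arm_count sum_nat_seq_eq0 => /allP N0.
  rewrite /arm_sum big_seq_cond big1// => t /andP[/N0]; rewrite /= => /eqP.
  by case: eqP.
have {IH} := IH N0.
set N := arm_count h k in N0 *; set S := arm_sum h k.
have N0' : 0 < N%:R :> R by rewrite ltr0n.
set a := S / N%:R => Sa.
have -> : S = a * N%:R by rewrite divfK// gt_eqF.
have N1 : 0 < N.+1%:R :> R by rewrite ltr0n.
have [ax|xa] := leP a x.
  apply: (is_interval_sample_values Sa Sx).
  rewrite ler_pdivlMr// ler_pdivrMr// -natr1 !mulrDr !mulr1 lerD2l ax /= lerD2r.
  by rewrite ler_wpM2r// ltW.
apply: (is_interval_sample_values Sx Sa).
rewrite ler_pdivlMr// ler_pdivrMr// -natr1 !mulrDr !mulr1 lerD2l (ltW xa) andbT lerD2r.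
by rewrite ler_wpM2r// ltW.
Qed.

(** A one-step identity at every history, for the arm that [rule] picks there. Integrability is
    included so that linear combinations with negative coefficients remain martingales. *)
Definition martingale mu W := forall h,
  let E := F (rule h) in
  let law x := ef_density (ef_base E) (param_of_mean E (mu 0 (rule h))) x in
  (ef_base E).-integrable setT (fun x => (law x * W (rcons h x))%:E) /\
  (\int[ef_base E]_x (law x * W (rcons h x))%:E = (W h)%:E)%E.

Lemma martingaleD mu W W' : martingale mu W -> martingale mu W' ->
  martingale mu (fun h => W h + W' h).
Proof.
move=> HW HW' h; have [i e] := HW h; have [i' e'] := HW' h; split.
  by under eq_fun do rewrite mulrDr EFinD; exact: integrableD.
by under eq_integral do rewrite mulrDr EFinD; rewrite integralD// e e' EFinD.
Qed.

Lemma martingaleZ mu c W : martingale mu W -> martingale mu (fun h => c * W h).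
Proof.
move=> HW h; have [i e] := HW h; split.
  by under eq_fun do rewrite mulrCA EFinM; exact: integrableZl.
by under eq_integral do rewrite mulrCA EFinM; rewrite integralZl// e EFinM.
Qed.

Lemma martingale0 mu : martingale mu (fun=> 0).
Proof.
move=> h; split; first by under eq_fun do rewrite mulr0; exact: integrable0.
by under eq_integral do rewrite mulr0; rewrite integral0.
Qed.

Lemma martingale_sum mu (J : Type) (s : seq J) (P : pred J) (W : J -> seq R -> R) :
  (forall j, P j -> martingale mu (W j)) ->
  martingale mu (fun h => \sum_(j <- s | P j) W j h).
Proof.
move=> HW; elim: s => [|j s IH].
  rewrite (_ : (fun h => _) = (fun=> 0)); first exact: martingale0.
  by apply/funext => h; rewrite big_nil.
rewrite (_ : (fun h => _) =
  (fun h => (if P j then W j h else 0) + \sum_(j <- s | P j) W j h)).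
  apply: martingaleD => //; have := HW j; case: (P j) => [/(_ isT)//|_].
  exact: martingale0.
by apply/funext => h; rewrite big_cons; case: ifPn => //; rewrite add0r.
Qed.

Lemma history_expect_ge0 mu (f : seq R -> \bar R) n h :
  (forall h, 0 <= f h)%E -> (0 <= history_expect F rule mu f n h)%E.
Proof.
move=> f0; elim: n h => //= n IH h; apply: integral_ge0 => x _.
by rewrite mule_ge0// lee_fin expR_ge0.
Qed.

(** Replacing [W h] by its one-step integral leaves a pointwise comparison with one sample fewer to
    come. *)
Lemma martingale_le_history_expect mu W (f : seq R -> \bar R) n h :
  martingale mu W -> (forall h, 0 <= f h)%E ->
  (forall h', size h' = (size h + n)%N -> ((W h')%:E <= f h')%E) ->
  ((W h)%:E <= history_expect F rule mu f n h)%E.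
Proof.
move=> HW f0; elim: n h => [|n IH] h Wf /=; first by rewrite Wf// addn0.
have [i <-] := HW h.
apply: integrable_le_lower_integral => // x.
  by rewrite mule_ge0 ?history_expect_ge0// lee_fin expR_ge0.
rewrite EFinM lee_wpmul2l ?lee_fin ?expR_ge0// IH// => h' sh'.
by apply: Wf; rewrite sh' size_rcons addSnnS.
Qed.

(** The same induction from above; samples outside [sample_values] form a null set, so [f] is
    bounded on typical histories only. *)
Lemma history_expect_le_martingale mu W (f : seq R -> \bar R) n h :
  martingale mu W -> (forall h, 0 <= f h)%E -> typical h ->
  (forall h', size h' = (size h + n)%N -> typical h' -> (f h' <= (W h')%:E)%E) ->
  (history_expect F rule mu f n h <= (W h)%:E)%E.
Proof.
move=> HW f0; elim: n h => [|n IH] h th Wf /=; first by rewrite Wf// addn0.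
have [i <-] := HW h.
apply: (lower_integral_le_integrable i _ (measurable_sample_values _)
  (sample_values_full _)) => x.
  by rewrite mule_ge0 ?history_expect_ge0// lee_fin expR_ge0.
move=> Sx; rewrite EFinM lee_wpmul2l ?lee_fin ?expR_ge0// IH//.
  exact/typical_rcons.
by move=> h' sh'; apply: Wf; rewrite sh' size_rcons addSnnS.
Qed.

(** Logarithm of the density ratio of [h] under [b] and under [mu], written with the sufficient
    statistics of each arm. *)
Definition log_lik_ratio mu b h : R := \sum_k
  ((nat_param (F k) (b 0 k) - nat_param (F k) (mu 0 k)) * arm_sum h k
   - (log_partition (F k) (nat_param (F k) (b 0 k))
      - log_partition (F k) (nat_param (F k) (mu 0 k))) * (arm_count h k)%:R).

Definition lik_ratio mu b h : R := expR (log_lik_ratio mu b h).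

Lemma log_lik_ratio_rcons mu b h x (k := rule h) :
  log_lik_ratio mu b (rcons h x) = log_lik_ratio mu b h +
  ((nat_param (F k) (b 0 k) - nat_param (F k) (mu 0 k)) * x
   - (log_partition (F k) (nat_param (F k) (b 0 k))
      - log_partition (F k) (nat_param (F k) (mu 0 k)))).
Proof.
rewrite /log_lik_ratio (bigD1 k)//= [in RHS](bigD1 k)//=.
rewrite arm_sum_rcons arm_count_rcons eqxx.
rewrite (eq_bigr (fun j => (nat_param (F j) (b 0 j) - nat_param (F j) (mu 0 j)) * arm_sum h j
   - (log_partition (F j) (nat_param (F j) (b 0 j))
      - log_partition (F j) (nat_param (F j) (mu 0 j))) * (arm_count h j)%:R)).
  by rewrite addn1 -natr1 mul1r; ring.
move=> j /negbTE jk; rewrite arm_sum_rcons arm_count_rcons eq_sym jk.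
by rewrite mul0r addr0 addn0.
Qed.

Lemma lik_ratio_nil mu b : lik_ratio mu b [::] = 1.
Proof.
rewrite /lik_ratio /log_lik_ratio big1 ?expR0// => k _.
by rewrite /arm_sum /arm_count !big_nil !mulr0 subr0.
Qed.

(** A new sample multiplies the ratio by the factor tilting its law under [mu] into its law under
    [b], whose density integrates to 1. *)
Lemma martingale_lik_ratio mu b : mean_vectors F b -> martingale mu (lik_ratio mu b).
Proof.
move=> Mb h E law.
have [Eb _] := nat_paramP (Mb (rule h)).
have lawE x : (law x * lik_ratio mu b (rcons h x))%:E =
    ((lik_ratio mu b h)%:E *
     (ef_density (ef_base E) (nat_param E (b 0 (rule h))) x)%:E)%E.
  rewrite -EFinM /lik_ratio log_lik_ratio_rcons expRD mulrCA; congr (_ * _)%:E.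
  by rewrite /law -nat_paramE -[RHS](@tilt_ef_density _ E (nat_param E (mu 0 (rule h)))).
have i := integrable_ef_density Eb.
split.
  rewrite (eq_fun lawE); exact: (integrableZl measurableT _ i).
under eq_integral do rewrite lawE.
by rewrite (integralZl _ i)// integral_ef_density// mule1.
Qed.

End histories.

(** * Likelihood ratios in terms of empirical means *)

Section likelihood.
Local Open Scope classical_set_scope.
Local Open Scope ring_scope.
Variables (R : realType) (K : nat) (F : 'I_K -> expFamily R).
Variable rule : seq R -> 'I_K.
Implicit Types (mu b l : 'rV[R]_K) (h : seq R) (k : 'I_K).

Definition kl_sum b mu : R := \sum_k kl (F k) (b 0 k) (mu 0 k).

Lemma kl_sum_ge0 b mu : mean_vectors F b -> mean_vectors F mu -> 0 <= kl_sum b mu.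
Proof. by move=> Mb Mm; apply: sumr_ge0 => k _; exact: kl_ge0. Qed.

(** Centring the empirical means at [b] leaves the divergences plus terms that are nonnegative when
    the empirical means lie beyond [b] as seen from [mu]. *)
Lemma log_lik_ratioE mu b h : (forall k, 0 < arm_count rule h k)%N ->
  log_lik_ratio F rule mu b h = \sum_k (arm_count rule h k)%:R *
    (kl (F k) (b 0 k) (mu 0 k) +
     (nat_param (F k) (b 0 k) - nat_param (F k) (mu 0 k)) *
     (arm_sum rule h k / (arm_count rule h k)%:R - b 0 k)).
Proof.
move=> N0; apply: eq_bigr => k _; rewrite klE.
have Nk : (arm_count rule h k)%:R != 0 :> R by rewrite pnatr_eq0 -lt0n.
rewrite -{1}(divfK Nk (arm_sum rule h k)); ring.
Qed.

Lemma log_lik_ratioD mu l b h : log_lik_ratio F rule mu b h =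
  log_lik_ratio F rule mu l h + log_lik_ratio F rule l b h.
Proof.
by rewrite /log_lik_ratio -big_split; apply: eq_bigr => k _ /=; ring.
Qed.

Lemma lik_ratio_refl mu h : lik_ratio F rule mu mu h = 1.
Proof.
rewrite /lik_ratio /log_lik_ratio big1 ?expR0// => k _.
by rewrite !subrr !mul0r subrr.
Qed.

(** Changing a single arm gives a likelihood ratio that tests the deviation of that arm's empirical
    mean. *)
Definition replace_mean l k x : 'rV[R]_K :=
  \row_j (if j == k then x else l 0 j).

Lemma replace_mean_mean_vectors l k x : mean_vectors F l -> means (F k) x ->
  mean_vectors F (replace_mean l k x).
Proof. by move=> Ml Mx j; rewrite mxE; case: eqP => [->|_]. Qed.

Lemma log_lik_ratio_replace l k x h : (forall k, 0 < arm_count rule h k)%N ->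
  log_lik_ratio F rule l (replace_mean l k x) h = (arm_count rule h k)%:R *
    (kl (F k) x (l 0 k) + (nat_param (F k) x - nat_param (F k) (l 0 k)) *
     (arm_sum rule h k / (arm_count rule h k)%:R - x)).
Proof.
move=> N0; rewrite log_lik_ratioE// (bigD1 k)//= mxE eqxx big1 ?addr0// => j jk.
by rewrite mxE (negbTE jk) kl_refl subrr mul0r addr0 mulr0.
Qed.

End likelihood.

(** * Lower bound on the error of static proportions *)

Section error_bounds.
Local Open Scope classical_set_scope.
Local Open Scope ring_scope.
Variables (R : realType) (K : nat) (F : 'I_K -> expFamily R) (I : finType).
Variable P : task F I.
Implicit Types (mu b l w : 'rV[R]_K) (A : algo_family R K I).

(** Weights on the simplex are at most 1, so for [K > 0] the default 1 leaves the minimum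
    unchanged. *)
Definition min_weight w : R := \big[Num.min/1]_(j < K) w 0 j.

Lemma min_weight_gt0 w : open_simplex w -> 0 < min_weight w.
Proof. by move=> [w0 _]; apply/bigmin_gtP; split. Qed.

Lemma min_weight_le w k : min_weight w <= w 0 k.
Proof. exact: bigmin_le. Qed.

(** The constant 1 is a martingale, being the likelihood ratio of [mu] against itself. *)
Lemma error_prob_le1 mu T (A : algorithm R K I T) : mean_vectors F mu ->
  (error_prob P mu A <= 1)%E.
Proof.
move=> Mmu; rewrite -(lik_ratio_nil F (alg_rule A) mu mu).
apply: history_expect_le_martingale => [|h||h _ _].
- exact: martingale_lik_ratio.
- by rewrite lee_fin.
- exact: typical_nil.
- by rewrite lik_ratio_refl lee_fin lern1 leq_b1.
Qed.

Lemma error_prob_ge0 mu T (A : algorithm R K I T) : (0 <= error_prob P mu A)%E.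
Proof. by apply: history_expect_ge0 => h; rewrite lee_fin. Qed.

Lemma static_count w A T (h : seq R) k : static_proportions P w A ->
  (0 < T)%N -> size h = T ->
  T%:R * min_weight w - K%:R <= (arm_count (alg_rule (A T)) h k)%:R :> R.
Proof.
move=> sA T0 /eqP sh; have [/(_ k) + _] := sA T (Tuple sh) T0.
rewrite /= -[num_samples _ _ _]/(arm_count (alg_rule (A T)) h k) ler_norml => /andP[+ _].
rewrite lerBrDl; apply: le_trans; rewrite lerD2r ler_wpM2l//.
exact: min_weight_le.
Qed.

Lemma static_answer w A T (h : seq R) : static_proportions P w A ->
  (0 < T)%N -> size h = T ->
  alg_answer (A T) h = task_ans P (empirical_mean (A T) h).
Proof. by move=> sA T0 /eqP sh; have [_] := sA T (Tuple sh) T0. Qed.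

Lemma empirical_meanE T (A : algorithm R K I T) h k : empirical_mean A h 0 k =
  arm_sum (alg_rule A) h k / (arm_count (alg_rule A) h k)%:R.
Proof. by rewrite mxE. Qed.

(* Change of measure from mu to l: under l the empirical means concentrate
   around l by Chernoff bounds, each of which is again a likelihood ratio. *)
Lemma error_prob_lower w A mu l (e : R) : (0 < K)%N -> open_simplex w ->
  static_proportions P w A -> task_dom P mu -> task_dom P l ->
  task_ans P l != task_ans P mu -> 0 < e ->
  \forall T \near \oo,
    ((expR (- (T%:R * (kl_sum F l mu + e))))%:E <= error_prob P mu (A T))%E.
Proof.
move=> K0 sw sA Dmu Dl lmu e0.
have Mmu := task_dom_sub Dmu; have Ml := task_dom_sub Dl.
pose th k := nat_param (F k).
have K0' : 0 < K%:R :> R by rewrite ltr0n.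
pose e' := e / 2.
have e'0 : 0 < e' by rewrite divr_gt0.
have nl : nbhs l (answer_region (task_dom P) (task_ans P) (task_ans P l)).
  by apply: open_nbhs_nbhs; split; [exact: task_open|].
case: nl => Q Qn QU.
(* The radii [d k] keep the box around [l] inside the region of its answer, keep the shifted means
   admissible, and limit the linear error of each arm to [e' / K]. *)
have /fin_all_exists[d dP] : forall k, exists d : R, [/\ 0 < d,
    means (F k) (l 0 k + d), means (F k) (l 0 k - d),
    (forall x, `|l 0 k - x| < d -> Q 0 k x) &
    `|th k (l 0 k) - th k (mu 0 k)| * d <= e' / K%:R].
  move=> k; have [r /= r0 rQ] := Qn 0 k.
  have [s /= s0 sM] : nbhs (l 0 k) (means (F k)).
    by apply: open_nbhs_nbhs; split; [exact: ef_means_open|exact: Ml].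
  pose C := `|th k (l 0 k) - th k (mu 0 k)| + 1.
  have C0 : 0 < C by rewrite ltr_wpDl.
  pose q := e' / K%:R / C.
  have q0 : 0 < q by rewrite !divr_gt0.
  pose d := Num.min r (Num.min (s / 2) q).
  have s20 : 0 < s / 2 by rewrite divr_gt0.
  have d0 : 0 < d by rewrite !lt_min r0 s20 q0.
  have ds : d < s.
    rewrite /d minC -minA gt_min; apply/orP; left.
    by rewrite ltr_pdivrMr// ltr_pMr// ltr1n.
  exists d; split => //.
  - by apply: sM => /=; rewrite opprD addrA subrr sub0r normrN gtr0_norm.
  - by apply: sM => /=; rewrite opprB addrC subrK gtr0_norm.
  - by move=> x xd; apply: rQ => /=; rewrite (lt_le_trans xd)// ge_min lexx.
  - apply: (@le_trans _ _ (C * q)); last by rewrite mulrC divfK// gt_eqF.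
    by apply: ler_pM => //; [exact: ltW|rewrite lerDl|rewrite !ge_min lexx !orbT].
pose c : R := \big[Num.min/1]_k Num.min (kl (F k) (l 0 k + d k) (l 0 k))
                                     (kl (F k) (l 0 k - d k) (l 0 k)).
have c0 : 0 < c.
  apply/bigmin_gtP; split => // k _; have [dk Mp Mm _ _] := dP k.
  rewrite lt_min !kl_gt0//; last by rewrite gt_eqF// ltrDl.
  by rewrite lt_eqF// ltrBlDr ltrDl.
have cle k : c <= kl (F k) (l 0 k + d k) (l 0 k) /\ c <= kl (F k) (l 0 k - d k) (l 0 k).
  by have := @bigmin_le _ _ 'I_K 1 k (fun k => Num.min (kl (F k) (l 0 k + d k) (l 0 k))
    (kl (F k) (l 0 k - d k) (l 0 k))); rewrite -/c le_min => /andP[].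
have wm0 := min_weight_gt0 sw.
near=> T.
have T0 : (0 < T)%N by near: T; exact: nbhs_infty_gt.
pose n : R := T%:R * min_weight w - K%:R.
have n0 : 0 < n.
  rewrite subr_gt0 -ltr_pdivrMr//; near: T; exact: nbhs_infty_gtr.
(* Makes [expR (- (n * c))] at most [1 / (4 * K)], so that the [2 * K] Chernoff terms initially
   remove at most half. *)
have nc : 4 * K%:R <= n * c.
  rewrite -ler_pdivrMr// lerBrDr -ler_pdivrMr//; near: T; exact: nbhs_infty_ger.
have Te : 1 <= T%:R * e'.
  rewrite -ler_pdivrMr//; near: T; exact: nbhs_infty_ger.
pose rule := alg_rule (A T).
pose V := kl_sum F l mu.
pose LR b h := lik_ratio F rule mu b h.
pose bp k := replace_mean l k (l 0 k + d k).
pose bm k := replace_mean l k (l 0 k - d k).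
(* [W] lies below the error indicator: with empirical means in the box around [l] the answer is
   wrong and [W <= 1]; otherwise one Chernoff term outweighs [LR l h] and [W <= 0]. *)
pose W h := expR (- (T%:R * (V + e'))) *
  (LR l h + (- expR (- (n * c))) * \sum_k (LR (bp k) h + LR (bm k) h)).
have HW : martingale F rule mu W.
  apply: martingaleZ; apply: martingaleD; first exact: martingale_lik_ratio.
  apply: martingaleZ; apply: martingale_sum => k _; have [_ Mp Mm _ _] := dP k.
  by apply: martingaleD; apply: martingale_lik_ratio; exact: replace_mean_mean_vectors.
apply: (@le_trans _ _ (W [::])%:E).
  rewrite lee_fin /W /LR lik_ratio_nil.
  under eq_bigr do rewrite !lik_ratio_nil.
  rewrite sumr_const card_ord mulNr.
  have -> : - (T%:R * (V + e)) = - (T%:R * (V + e')) + - (T%:R * e').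
    by rewrite /e'; lra.
  rewrite expRD ler_wpM2l ?expR_ge0//.
  have E1 : expR (- (T%:R * e')) <= 2^-1.
    rewrite expRN lef_pV2 ?posrE ?expR_gt0//.
    by rewrite (le_trans _ (expR_ge1Dx _))//; lra.
  have E2 : expR (- (n * c)) <= (4 * K%:R)^-1.
    rewrite expRN lef_pV2 ?posrE ?expR_gt0 ?mulr_gt0//.
    by rewrite (le_trans _ (expR_ge1Dx _))//; lra.
  apply: (le_trans E1).
  have : expR (- (n * c)) * (1 + 1) *+ K <= 2^-1.
    rewrite -[X in X <= _]mulr_natr.
    apply: (@le_trans _ _ ((4 * K%:R)^-1 * 2 * K%:R)).
      by rewrite ler_wpM2r// ler_wpM2r.
    have -> : (4 * K%:R)^-1 * 2 * K%:R = 2^-1 :> R by field; rewrite gt_eqF.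
    by [].
  by rewrite mulrnAr; lra.
apply: martingale_le_history_expect => // h.
rewrite /= add0n => sh; rewrite lee_fin.
have Nn k : n <= (arm_count rule h k)%:R by exact: (static_count _ sA).
have N0 k : (0 < arm_count rule h k)%N.
  by rewrite -(ltr0n R); exact: lt_le_trans (Nn k).
pose x k := arm_sum rule h k / (arm_count rule h k)%:R.
have LR0 b : 0 <= LR b h by exact: expR_ge0.
have W_le0 k : LR l h <= expR (- (n * c)) * (LR (bp k) h + LR (bm k) h) -> W h <= 0.
  move=> LRl; rewrite /W mulr_ge0_le0 ?expR_ge0// mulNr subr_le0 (le_trans LRl)//.
  rewrite ler_wpM2l ?expR_ge0// (bigD1 k)//= lerDl sumr_ge0// => j _.
  by rewrite addr_ge0.
(* If the empirical mean of arm [k] lies beyond [z], the ratio of the shifted problem against [l] is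
   at least [expR (n * c)]. *)
have LR_far k z : c <= kl (F k) z (l 0 k) ->
    0 <= (th k z - th k (l 0 k)) * (x k - z) ->
    LR l h <= expR (- (n * c)) * LR (replace_mean l k z) h.
  move=> cz xz; rewrite /LR /lik_ratio -expRD ler_expR (log_lik_ratioD _ _ _ l (replace_mean l k z)).
  rewrite addrCA lerDl log_lik_ratio_replace// addrC subr_ge0.
  apply: ler_pM; rewrite ?(ltW n0) ?(ltW c0)//.
  by rewrite (le_trans cz)// lerDl.
have [near_l|/existsNP[k /negP]] := pselect (forall k, `|l 0 k - x k| < d k).
  have -> : alg_answer (A T) h = task_ans P l.
    rewrite (static_answer sA T0 sh); have [] // := QU (empirical_mean (A T) h).
    move=> i k; rewrite (ord1 i) empirical_meanE; have [_ _ _ + _] := dP k.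
    by apply; exact: near_l.
  rewrite lmu (@le_trans _ _ (expR (- (T%:R * (V + e'))) * LR l h))//.
    rewrite /W ler_wpM2l ?expR_ge0// mulNr gerDl oppr_le0 mulr_ge0 ?expR_ge0//.
    by apply: sumr_ge0 => k _; rewrite addr_ge0.
  rewrite /LR /lik_ratio -expRD -[X in _ <= X]expR0 ler_expR addrC subr_le0.
  rewrite log_lik_ratioE//.
  have -> : V + e' = \sum_k (kl (F k) (l 0 k) (mu 0 k) + e' / K%:R).
    rewrite big_split /= sumr_const card_ord; congr (_ + _).
    by rewrite -[RHS]mulr_natr divfK// gt_eqF.
  rewrite mulr_sumr; apply: ler_sum => k _.
  have kl0 : 0 <= kl (F k) (l 0 k) (mu 0 k) by exact: kl_ge0.
  apply: (@le_trans _ _ ((arm_count rule h k)%:R *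
      (kl (F k) (l 0 k) (mu 0 k) + e' / K%:R))).
    rewrite ler_wpM2l// lerD2l (le_trans (ler_norm _))// normrM.
    have [d0 _ _ _] := dP k; apply: le_trans.
    by rewrite ler_wpM2l// distrC ltW.
  apply: ler_wpM2r; last by rewrite ler_nat -sh arm_count_le.
  by rewrite addr_ge0// divr_ge0// ltW.
rewrite -leNgt => far; rewrite (@le_trans _ _ 0)//.
have [d0 Mp Mm _ _] := dP k; have [cp cm] := cle k.
apply: (W_le0 k); rewrite mulrDr.
have [xl|lx] := leP (x k) (l 0 k).
  apply: (@le_trans _ _ (expR (- (n * c)) * LR (bm k) h)); last first.
    by rewrite lerDr mulr_ge0// expR_ge0.
  apply: LR_far => //; rewrite mulr_le0// subr_le0.
    by rewrite nat_param_le// lerBlDr lerDl ltW.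
  by move: far; rewrite ger0_norm ?subr_ge0// lerBrDr -lerBrDl.
apply: (@le_trans _ _ (expR (- (n * c)) * LR (bp k) h)); last first.
  by rewrite lerDl mulr_ge0// expR_ge0.
apply: LR_far => //; rewrite mulr_ge0// subr_ge0.
  by rewrite nat_param_le// lerDl ltW.
by move: far; rewrite distrC gtr0_norm ?subr_gt0// lerBrDr addrC.
Unshelve. all: by end_near. Qed.

End error_bounds.

(** * Upper bound on the error of static proportions *)

Section error_upper.
Local Open Scope classical_set_scope.
Local Open Scope ring_scope.
Variables (R : realType) (K : nat) (F : 'I_K -> expFamily R) (I : finType).
Variable P : task F I.
Implicit Types (mu b l w : 'rV[R]_K) (A : algo_family R K I).

(** Were some neighbourhood of [x] free of alternatives, [x] would avoid the closures of all other
    regions, and the consistent extension would answer correctly. *)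
Lemma wrong_answer_near mu (x : 'rV[R]_K) (U : set 'rV[R]_K) :
  consistent_extension P -> reachable F x -> task_ans P x != task_ans P mu ->
  nbhs x U -> exists2 l, U l & task_dom P l /\ task_ans P l != task_ans P mu.
Proof.
move=> Pext Rx wrong xU; apply: contrapT => noU.
move/negP: wrong; apply; apply/eqP; apply: Pext => // j jmu clj.
have [l [[Dl lj] Ul]] := clj _ xU.
by apply: noU; exists l => //; rewrite lj.
Qed.

(** Product of the one-arm grids of precision [e / K]; [f] selects a grid index for each arm, which
    makes the family of apices finite. *)
Lemma kl_sum_grid mu (B e : R) : (0 < K)%N -> mean_vectors F mu -> 0 < e ->
  exists N, exists b : {ffun 'I_K -> 'I_N} -> 'rV[R]_K,
    (forall f, mean_vectors F (b f)) /\
    forall x : 'rV[R]_K, exists f, exists2 U, nbhs x U &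
      (forall k, 0 <= (nat_param (F k) (b f 0 k) - nat_param (F k) (mu 0 k))
                      * (x 0 k - b f 0 k)) /\
      (forall l, mean_vectors F l -> U l -> B <= kl_sum F l mu ->
        B - e <= kl_sum F (b f) mu).
Proof.
move=> K0 Mmu e0; have K0' : 0 < K%:R :> R by rewrite ltr0n.
pose e' := e / K%:R; have e'0 : 0 < e' by rewrite divr_gt0.
have e'e : e' <= e.
  by rewrite ler_pdivrMr// ler_peMr ?(ltW e0)// ler1n.
have /fin_all_exists[s sP] := fun k => kl_grid B (Mmu k) e'0.
pose N := \max_k size (s k).
(* Indices past the end of [s k] default to [mu 0 k], so every [b f] is a mean vector. *)
pose b (f : {ffun 'I_K -> 'I_N}) : 'rV[R]_K := \row_k nth (mu 0 k) (s k) (f k).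
have Mb f : mean_vectors F (b f).
  move=> k; rewrite mxE; have [fs|fs] := ltnP (f k) (size (s k)).
    by apply: (sP k).1; exact: mem_nth.
  by rewrite nth_default.
exists N, b; split => // x.
have /fin_all_exists[y yP] := fun k => (sP k).2 (x 0 k).
have ix k : (index (y k) (s k) < N)%N.
  have [ys _ _] := yP k; rewrite -index_mem in ys.
  by rewrite (leq_trans ys)//; exact: leq_bigmax.
pose f := [ffun k => Ordinal (ix k)].
have bf k : b f 0 k = y k.
  by rewrite mxE ffunE /= nth_index//; have [] := yP k.
pose U := [set l : 'rV[R]_K | forall k, means (F k) (l 0 k) ->
  Num.min B (kl (F k) (l 0 k) (mu 0 k)) <= kl (F k) (y k) (mu 0 k) + e'].
exists f, U.
  exists (fun _ k => [set z | means (F k) z ->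
      Num.min B (kl (F k) z (mu 0 k)) <= kl (F k) (y k) (mu 0 k) + e']).
    by move=> i k; rewrite (ord1 i); have [_ _] := yP k.
  by move=> l /= H k; exact: H.
split=> [k|l Ml Ul Bl]; first by rewrite bf; have [] := yP k.
have kb0 k : 0 <= kl (F k) (b f 0 k) (mu 0 k) by exact: (kl_ge0 (Mb f k) (Mmu k)).
(* If one arm alone has divergence at least [B], its capped bound suffices; otherwise no cap is
   active and the [K] errors add up to [e]. *)
have [[k Bk]|/forallNP nB] := pselect (exists k, B <= kl (F k) (l 0 k) (mu 0 k)).
  have := Ul k (Ml k); rewrite min_l// -bf => Bb.
  rewrite lerBlDr (le_trans Bb)// lerD// /kl_sum (bigD1 k)//= lerDl.
  by rewrite sumr_ge0.
rewrite lerBlDr (le_trans Bl)//.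
have -> : e = \sum_(k < K) e'.
  by rewrite sumr_const card_ord -[RHS]mulr_natr divfK// gt_eqF.
rewrite -big_split; apply: ler_sum => k _ /=.
have := Ul k (Ml k); rewrite min_r -?bf//.
by have /negP := nB k; rewrite -ltNge => /ltW.
Qed.

(** A union bound over the apices: [C] counts those of divergence at least [B - e] and does not
    depend on [T]. *)
Lemma error_prob_upper w A mu (B e : R) : consistent_extension P ->
  (0 < K)%N -> open_simplex w -> static_proportions P w A -> task_dom P mu ->
  (forall l, task_dom P l -> task_ans P l != task_ans P mu ->
     B <= kl_sum F l mu) -> 0 < e ->
  exists C : nat, \forall T \near \oo, (error_prob P mu (A T) <=
    (C%:R * expR (- ((T%:R * min_weight w - K%:R) * (B - e))))%:E)%E.
Proof.
move=> Pext K0 sw sA Dmu HB e0; have Mmu := task_dom_sub Dmu.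
have [N [b [Mb bP]]] := kl_sum_grid B K0 Mmu e0.
pose S := [pred f | B - e <= kl_sum F (b f) mu].
exists #|S|.
have wm0 := min_weight_gt0 sw.
near=> T.
have T0 : (0 < T)%N by near: T; exact: nbhs_infty_gt.
pose n : R := T%:R * min_weight w - K%:R.
have n0 : 0 < n.
  rewrite subr_gt0 -ltr_pdivrMr//; near: T; exact: nbhs_infty_gtr.
pose rule := alg_rule (A T).
pose q := expR (- (n * (B - e))).
pose W h := q * \sum_(f in S) lik_ratio F rule mu (b f) h.
have -> : #|S|%:R * expR (- ((T%:R * min_weight w - K%:R) * (B - e))) = W [::].
  rewrite /W; under eq_bigr do rewrite lik_ratio_nil.
  by rewrite sumr_const mulrC.
apply: history_expect_le_martingale => //.
  by apply: martingaleZ; apply: martingale_sum => f _; exact: martingale_lik_ratio.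
move=> h; rewrite /= add0n => sh th.
have sum0 (S' : pred {ffun 'I_K -> 'I_N}) :
    0 <= \sum_(f | S' f) lik_ratio F rule mu (b f) h.
  by apply: sumr_ge0 => f _; exact: expR_ge0.
rewrite lee_fin; have [_|wrong] := eqVneq; first by rewrite mulr_ge0 ?expR_ge0.
rewrite (static_answer sA T0 sh) in wrong.
have Nn k : n <= (arm_count rule h k)%:R by exact: (static_count _ sA).
have N0 k : (0 < arm_count rule h k)%N.
  by rewrite -(ltr0n R); exact: lt_le_trans (Nn k).
set x := empirical_mean _ _ in wrong.
have Rx : reachable F x.
  by move=> k; rewrite empirical_meanE; exact: typical_average.
have [f [U xU [signs Bf]]] := bP x.
have [l Ul [Dl lmu]] := wrong_answer_near Pext Rx wrong xU.
have {}Bf : B - e <= kl_sum F (b f) mu.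
  by apply: (Bf l) => //; [exact: (task_dom_sub Dl)|exact: HB].
rewrite /W (bigD1 f)//= mulrDr (@le_trans _ _ (q * lik_ratio F rule mu (b f) h))//.
  rewrite /q /lik_ratio -expRD -[X in X <= _]expR0 ler_expR addrC subr_ge0.
  rewrite log_lik_ratioE//.
  apply: (@le_trans _ _ (n * kl_sum F (b f) mu)); first by rewrite ler_wpM2l// ltW.
  rewrite mulr_sumr; apply: ler_sum => k _.
  apply: ler_pM => //; [exact: ltW|exact: (kl_ge0 (Mb f k) (Mmu k))|].
  by rewrite lerDl; have := signs k; rewrite empirical_meanE.
by rewrite lerDl mulr_ge0// expR_ge0.
Unshelve. all: by end_near. Qed.

End error_upper.

(** * Eventual bounds pass to upper limits *)

Section limn_esup_bounds.
Local Open Scope classical_set_scope.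
Local Open Scope ereal_scope.
Variable R : realType.
Implicit Types (u : (\bar R)^nat) (c : \bar R).

Lemma limn_esup_ge u c : (\forall n \near \oo, c <= u n) -> c <= limn_esup u.
Proof.
move=> cu; apply: le_ereal_inf_tmp => _ [V /= ooV <-].
have [n [Vn cun]] : (V `&` [set n | c <= u n]) !=set0.
  by apply: (@filter_ex _ \oo); exact: filterI.
by apply: (le_trans cun); apply: ereal_sup_ubound; exists n.
Qed.

Lemma limn_esup_le u c : (\forall n \near \oo, u n <= c) -> limn_esup u <= c.
Proof.
move=> uc; apply: (@le_trans _ _ (ereal_sup (u @` [set n | u n <= c]))).
  by apply: ereal_inf_lbound; exists [set n | u n <= c].
by apply: ge_ereal_sup => _ [n /= unc <-].
Qed.

End limn_esup_bounds.

(** * From error exponents to difficulty ratios *)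

Section oracle.
Local Open Scope classical_set_scope.
Local Open Scope ring_scope.
Variables (R : realType) (K : nat) (F : 'I_K -> expFamily R) (I : finType).
Variable P : task F I.
Hypothesis K0 : (0 < K)%N.
Hypothesis Pext : consistent_extension P.
Implicit Types (mu b l w : 'rV[R]_K) (A : algo_family R K I).

Lemma error_prob_fin mu T (A : algorithm R K I T) : mean_vectors F mu ->
  error_prob P mu A = (fine (error_prob P mu A))%:E.
Proof.
move=> Mmu; rewrite fineK// ge0_fin_numE ?error_prob_ge0//.
by rewrite (le_lt_trans (error_prob_le1 P A Mmu))// ltry.
Qed.

Lemma difficulty_ge w A mu l (e : R) : open_simplex w ->
  static_proportions P w A -> task_dom P mu -> task_dom P l ->
  task_ans P l != task_ans P mu -> 0 < e ->
  \forall T \near \oo, (((kl_sum F l mu + e)^-1)%:E <= difficulty P mu A T)%E.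
Proof.
move=> sw sA Dmu Dl lmu e0.
have Mmu := task_dom_sub Dmu.
have V0 : 0 < kl_sum F l mu + e.
  by rewrite ltr_wpDl// kl_sum_ge0//; exact: (task_dom_sub Dl).
near=> T.
have T0 : (0 < T)%N by near: T; exact: nbhs_infty_gt.
have : ((expR (- (T%:R * (kl_sum F l mu + e))))%:E <= error_prob P mu (A T))%E.
  by near: T; exact: error_prob_lower sw sA Dmu Dl lmu e0.
have := error_prob_le1 P (A T) Mmu.
rewrite /difficulty (error_prob_fin (A T) Mmu) /= !lee_fin.
set p := fine _ => p1 lep.
have p0 : 0 < p by apply: lt_le_trans lep; exact: expR_gt0.
rewrite gt_eqF//; have [_|np1] := eqVneq; first by rewrite leey.
have {np1}p1 : p < 1 by rewrite lt_neqAle np1.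
have lnp : 0 < ln p^-1 by rewrite ln_gt0// invf_gt1.
rewrite lee_fin ler_pdivlMr// mulrC ler_pdivrMr// -ler_expR lnK ?posrE ?invr_gt0//.
by rewrite invf_ple ?posrE ?expR_gt0// -expRN.
Unshelve. all: by end_near. Qed.

Lemma difficulty_le w A mu (B B' : R) : open_simplex w ->
  static_proportions P w A -> task_dom P mu ->
  (forall l, task_dom P l -> task_ans P l != task_ans P mu ->
     B <= kl_sum F l mu) -> 0 < B' -> B' < B ->
  \forall T \near \oo, (difficulty P mu A T <= ((min_weight w * B')^-1)%:E)%E.
Proof.
move=> sw sA Dmu HB B'0 B'B.
have Mmu := task_dom_sub Dmu; have wm0 := min_weight_gt0 sw.
(* Half the gap: since [B - e = B' + e], a factor [expR (- (T * min_weight w * e))] is left to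
   absorb the constants. *)
pose e := (B - B') / 2.
have e0 : 0 < e by rewrite divr_gt0// subr_gt0.
have [C CP] := error_prob_upper Pext K0 sw sA Dmu HB e0.
near=> T.
have T0 : (0 < T)%N by near: T; exact: nbhs_infty_gt.
have Tb : C%:R * expR (K%:R * (B - e)) <= T%:R * (min_weight w * e).
  rewrite -ler_pdivrMr ?(mulr_gt0 wm0 e0)//; near: T; exact: nbhs_infty_ger.
have : (error_prob P mu (A T) <=
    (C%:R * expR (- ((T%:R * min_weight w - K%:R) * (B - e))))%:E)%E by near: T.
have := error_prob_ge0 P mu (A T).
rewrite /difficulty (error_prob_fin (A T) Mmu) /= !lee_fin.
set p := fine _ => p_ge0 lep.
have wB0 : 0 < min_weight w * B' by rewrite mulr_gt0.
have [_|p0] := eqVneq; first by rewrite lee_fin invr_ge0 ltW.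
have {p0 p_ge0}p0 : 0 < p by rewrite lt_neqAle eq_sym p0.
have TwB : 0 < T%:R * (min_weight w * B') by rewrite mulr_gt0// ltr0n.
have {}lep : p <= expR (- (T%:R * (min_weight w * B'))).
  apply: (le_trans lep).
  have -> : - ((T%:R * min_weight w - K%:R) * (B - e)) =
      K%:R * (B - e) + - (T%:R * (min_weight w * e)) - T%:R * (min_weight w * B').
    by rewrite /e; field.
  rewrite !expRD !mulrA ler_piMl ?expR_ge0// expRN ler_pdivrMr ?expR_gt0// mul1r.
  by apply: (le_trans Tb); apply: le_trans (expR_ge1Dx _); rewrite -!mulrA lerDr.
have p1 : p < 1 by rewrite (le_lt_trans lep)// expR_lt1 oppr_lt0.
have lnp : T%:R * (min_weight w * B') <= ln p^-1.
  by rewrite -ler_expR lnK ?posrE ?invr_gt0// invf_pge ?posrE ?expR_gt0// -expRN.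
rewrite lt_eqF// lee_fin ler_pdivrMr ?(lt_le_trans TwB)//.
by rewrite ler_pdivlMl// mulrC.
Unshelve. all: by end_near. Qed.

Lemma alternative_exists mu : task_dom P mu ->
  exists2 l, task_dom P l & task_ans P l != task_ans P mu.
Proof.
move=> Dmu; have [i [j [ij [a [Da ai]] [b [Db bj]]]]] := task_nontrivial P.
have [imu|imu] := eqVneq i (task_ans P mu); last by exists a; rewrite ?ai.
by exists b; rewrite // bj -imu eq_sym.
Qed.

Definition kl_alternatives mu : set R := (fun l => kl_sum F l mu) @`
  [set l | task_dom P l /\ task_ans P l != task_ans P mu].

Lemma has_inf_kl_alternatives mu : task_dom P mu -> has_inf (kl_alternatives mu).
Proof.
move=> Dmu; have Mmu := task_dom_sub Dmu; split.
  by have [l Dl lmu] := alternative_exists Dmu; exists (kl_sum F l mu), l.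
by exists 0 => _ [l [Dl _] <-]; exact: (kl_sum_ge0 (task_dom_sub Dl)).
Qed.

(** The slack [e] serves because the infimum may not be attained and may be 0, where its inverse
    would be 0 by convention. *)
Lemma oracle_difficulty_ge mu (e : R) : task_dom P mu -> 0 < e ->
  (((inf (kl_alternatives mu) + e)^-1)%:E <= oracle_difficulty P (Csp P) mu)%E.
Proof.
move=> Dmu e0; apply: le_ereal_inf_tmp => _ [A [w sw sA] <-].
have e20 : 0 < e / 2 by rewrite divr_gt0.
have [_ [l [Dl lmu] <-] linf] := inf_adherent e20 (has_inf_kl_alternatives Dmu).
apply: (@le_trans _ _ ((kl_sum F l mu + e / 2)^-1)%:E); last first.
  by apply: limn_esup_ge; exact: difficulty_ge sw sA Dmu Dl lmu e20.
have V0 : 0 <= kl_sum F l mu by exact: (kl_sum_ge0 (task_dom_sub Dl) (task_dom_sub Dmu)).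
rewrite lee_fin lef_pV2 ?posrE; lra.
Qed.

Lemma difficulty_ratio_lim_le w A mu : open_simplex w ->
  static_proportions P w A -> task_dom P mu ->
  (difficulty_ratio_lim P (oracle_difficulty P (Csp P)) A mu
    <= ((min_weight w)^-1)%:E)%E.
Proof.
move=> sw sA Dmu; have wm0 := min_weight_gt0 sw.
set D := inf (kl_alternatives mu).
have D0 : 0 <= D.
  apply: lb_le_inf; first exact: (has_inf_kl_alternatives Dmu).1.
  by move=> _ [l [Dl _] <-]; exact: (kl_sum_ge0 (task_dom_sub Dl) (task_dom_sub Dmu)).
have HD l : task_dom P l -> task_ans P l != task_ans P mu -> D <= kl_sum F l mu.
  move=> Dl lmu; apply: ge_inf; last by exists l.
  exact: (has_inf_kl_alternatives Dmu).2.
have := oracle_difficulty_ge Dmu; rewrite -/D /difficulty_ratio_lim.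
case HE : oracle_difficulty => [r| |] Hge; last first.
- by have := Hge 1 ltr01; rewrite leeNy_eq.
(* An infinite oracle difficulty has inverse 0, so the ratio is 0. *)
- apply: limn_esup_le; near=> T.
  by rewrite /difficulty_ratio HE invey mule0 lee_fin invr_ge0 ltW.
have r0 : 0 < r.
  have := Hge 1 ltr01; rewrite lee_fin; apply: lt_le_trans.
  by rewrite invr_gt0 ltr_wpDl.
(* Letting the slack tend to 0 gives [1 / r <= D], so finiteness of the oracle difficulty forces
   [D > 0]. *)
have rD : 1 <= D * r.
  rewrite -ler_pdivrMr// div1r; apply/ler_addgt0Pr => e e0.
  by rewrite invf_ple ?posrE ?ltr_wpDl// -lee_fin; exact: Hge.
have {}D0 : 0 < D by rewrite -(pmulr_lgt0 _ r0) (lt_le_trans ltr01).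
apply/lee_addgt0Pr => e e0; rewrite -EFinD.
(* Chosen so that [min_weight w / g] is the inverse of [(min_weight w)^-1 + e]. *)
pose g := 1 + e * min_weight w.
have g1 : 1 < g by rewrite ltrDl mulr_gt0.
have g0 : 0 < g by exact: lt_trans g1.
have Dg0 : 0 < D / g by rewrite divr_gt0.
have DgD : D / g < D by rewrite ltr_pdivrMr// ltr_pMr.
apply: limn_esup_le; have := difficulty_le sw sA Dmu HD Dg0 DgD.
apply: filterS => T diffT.
rewrite /difficulty_ratio HE inver gt_eqF//.
apply: (@le_trans _ _ (((min_weight w * (D / g))^-1)%:E * (r^-1)%:E)%E).
  by apply: lee_wpmul2r => //; rewrite lee_fin invr_ge0 ltW.
rewrite -EFinM lee_fin -invfM invf_ple ?posrE ?mulr_gt0 ?addr_gt0 ?invr_gt0//.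
have -> : ((min_weight w)^-1 + e)^-1 = min_weight w / g.
  by rewrite /g; field; rewrite !gt_eqF// addr_gt0// mulr_gt0.
have -> : min_weight w * (D / g) * r = min_weight w / g * (D * r) by field; rewrite gt_eqF.
by rewrite ler_peMr// divr_ge0// ltW.
Unshelve. all: by end_near. Qed.

Lemma sup_difficulty_ratio_le w A : open_simplex w -> static_proportions P w A ->
  (sup_difficulty_ratio P (oracle_difficulty P (Csp P)) A
    <= ((min_weight w)^-1)%:E)%E.
Proof.
by move=> sw sA; apply: ge_ereal_sup => _ [mu Dmu <-]; exact: difficulty_ratio_lim_le.
Qed.

End oracle.

(** * Uniform proportions and the final bounds *)

Lemma open_simplex_uniform (R : realType) (K : nat) : (0 < K)%N ->
  open_simplex (const_mx K%:R^-1 : 'rV[R]_K)%R.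
Proof.
move=> K0; split=> [k|]; first by rewrite mxE invr_gt0 ltr0n.
under eq_bigr do rewrite mxE.
rewrite sumr_const card_ord -[LHS]mulr_natr mulVf//.
by rewrite pnatr_eq0 -lt0n.
Qed.

Lemma min_weight_uniform (R : realType) (K : nat) : (0 < K)%N ->
  min_weight (const_mx K%:R^-1 : 'rV[R]_K)%R = (K%:R^-1)%R.
Proof.
case: K => // K _; apply/eqP; rewrite eq_le; apply/andP; split.
  by have := min_weight_le (const_mx K.+1%:R^-1 : 'rV[R]_K.+1)%R ord0; rewrite mxE.
apply: le_bigmin => [|k _]; last by rewrite mxE.
by rewrite invf_le1 ?ler1n ?ltr0n.
Qed.

Theorem theorem5 (R : realType) (K : nat) (K_gt0 : (0 < K)%N)
    (F : 'I_K -> expFamily R) (I : finType) (P : task F I)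
    (P_ext : consistent_extension P) :
  (forall (w : 'rV[R]_K) (A : algo_family R K I),
     open_simplex w -> static_proportions P w A ->
     Csp_bar P A /\
     (sup_difficulty_ratio P (oracle_difficulty P (Csp P)) A
        <= ((\big[Num.min/1]_(j < K) w 0 j)^-1)%:E)%E) /\
  (forall Au : algo_family R K I,
     static_proportions P (const_mx (K%:R^-1 : R)%R) Au ->
     Csp P Au /\
     (sup_difficulty_ratio P (oracle_difficulty P (Csp P)) Au <= (K%:R)%:E)%E).
Proof.
split=> [w A sw sA|Au sA].
  have le_w := sup_difficulty_ratio_le K_gt0 P_ext sw sA.
  by split; [exact: le_lt_trans le_w (ltry _)|exact: le_w].
have su := open_simplex_uniform R K_gt0.
split; first by exists (const_mx K%:R^-1)%R.
have := sup_difficulty_ratio_le K_gt0 P_ext su sA.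
by rewrite min_weight_uniform// invrK.
Qed.
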